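(* Let $e=2.718281\ldots$ be Euler's number, and let $s_k/t_k$, $k\ge 0$, be the convergents of its regular continued fraction expansion. Then the Jacobi sequence of $e$ is purely periodic with period length $24$, i.e. $$\left(\frac{s_k}{t_k}\right)=\left(\frac{s_{k+24}}{t_{k+24}}\right)\quad\text{for all } k\ge 0,$$ and $24$ is the smallest positive integer $L$ with $\left(\frac{s_k}{t_k}\right)=\left(\frac{s_{k+L}}{t_{k+L}}\right)$ for all $k\ge 0$.
   Context: For $x\in\mathbb{R}\setminus\mathbb{Q}$ with regular continued fraction expansion $x=[a_0,a_1,a_2,\ldots]$ ($a_0\in\mathbb{Z}$, $a_i\ge 1$ for $i\ge1$), the convergents $s_k/t_k$ are defined by $s_{-1}=1$, $s_0=a_0$, $s_k=a_ks_{k-1}+s_{k-2}$ and $t_{-1}=0$, $t_0=1$, $t_k=a_kt_{k-1}+t_{k-2}$ for $k\ge1$. For an odd natural number $n$ and an integer $m$ coprime to $n$, $\left(\frac{m}{n}\right)$ is the usual Jacobi symbol (equal to $1$ when $n=1$, e.g. $m=0,n=1$). If $n$ is even and $\gcd(m,n)=1$, one sets $\left(\frac{m}{n}\right)=*$, where $*$ is a fixed symbol different from $\pm1$. The Jacobi sequence of $x$ is the sequence $\left(\frac{s_k}{t_k}\right)$, $k\ge 0$, with values in $\{1,-1,*\}$. *)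

(* Defs.v *)
From HB Require Import structures.
From mathcomp Require Import all_boot all_order all_algebra.
From mathcomp Require Import all_classical all_reals all_analysis.
Set Implicit Arguments. Unset Strict Implicit. Unset Printing Implicit Defensive.
Import Order.TTheory GRing.Theory Num.Theory.
Local Open Scope ring_scope.

Section CF.
Variable R : realType.

Fixpoint cf_rem (x : R) (k : nat) : R :=
  match k with
  | 0%N => x
  | k'.+1 => (cf_rem x k' - (Num.floor (cf_rem x k'))%:~R)^-1
  end.

Definition cf_a (x : R) (k : nat) : int := Num.floor (cf_rem x k).

(* (s_{k-1}, s_k, t_{k-1}, t_k) *)
Fixpoint conv_aux (x : R) (k : nat) : int * int * int * int :=
  match k with
  | 0%N => (1, cf_a x 0, 0, 1)
  | k'.+1 =>
      let: (sp, s, tp, t) := conv_aux x k' in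
      let a := cf_a x k in
      (s, a * s + sp, t, a * t + tp)
  end.

Definition conv_s (x : R) (k : nat) : int :=
  let: (_, s, _, _) := conv_aux x k in s.
Definition conv_t (x : R) (k : nat) : int :=
  let: (_, _, _, t) := conv_aux x k in t.
End CF.

Definition legendre (m : int) (p : nat) : int :=
  if (p%:Z %| m)%Z then 0
  else if [exists x : 'I_p, ((x%:Z * x%:Z - m) %% p%:Z)%Z == 0] then 1 else -1.

Definition jacobi (m : int) (n : nat) : int :=
  \prod_(pe <- prime_decomp n) legendre m pe.1 ^+ pe.2.

(* values of the Jacobi sequence: 1, -1, the symbol * (n even),
   and JUndef for the (never occurring for convergents) non-coprime case *)
Inductive jac_val := JPos | JNeg | JStar | JUndef.

Definition jac_sym (m : int) (n : nat) : jac_val :=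
  if ~~ coprime `|m|%N n then JUndef
  else if ~~ odd n then JStar
  else if jacobi m n == 1 then JPos else JNeg.

Definition jacobi_seq (R : realType) (x : R) (k : nat) : jac_val :=
  jac_sym (conv_s x k) `|conv_t x k|%N.

(* Main.v *)
(** Put (m / n) for odd n as the parity of the number of x <= (n-1)/2 whose
    multiple m x has residue > n/2 modulo n (Gauss and Schering).  It is
    n-periodic and multiplicative in m, satisfies quadratic reciprocity by a
    lattice-point count, and is then multiplicative in n by reciprocity; Gauss's
    lemma identifies it with the Jacobi symbol.

    From s_k t_{k-1} - s_{k-1} t_k = +-1 the symbol (s_k / t_k) is
    (t_{k-1} / t_k) up to (-1 / t_k).  If t_{k-1} is odd, reciprocity and
    t_k = t_{k-2} mod t_{k-1} reduce (t_{k-1} / t_k) to (t_{k-2} / t_{k-1}).  For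
    e = [2, 1, 2, 1, 1, 4, 1, 1, 6, ...], an even t_{k-1} is always followed by
    the quotient 1, so that t_k - t_{k-1} = t_{k-2} is odd, and (2 / n) never has
    to be evaluated.  Hence the Jacobi sequence is the output of a finite
    automaton reading the partial quotients modulo 4.

    The expansion of e comes from Cohn's integrals of x^n (1 - x)^m exp x over
    [0, 1], handled here through their series. *)
Require Import Defs.
From HB Require Import structures.
From mathcomp Require Import all_boot all_order all_algebra.
From mathcomp Require Import all_fingroup all_solvable all_field.
From mathcomp Require Import all_classical all_reals all_analysis.
From mathcomp Require Import zify ring lra.
Set Implicit Arguments. Unset Strict Implicit. Unset Printing Implicit Defensive.
Import Order.TTheory GRing.Theory Num.Theory numFieldNormedType.Exports.
Local Open Scope ring_scope.

(** * The Gauss-Schering symbol and quadratic reciprocity *)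

Section GaussSchering.
Local Open Scope nat_scope.

(* Symbols are booleans: [true] stands for -1 and [(+)] for the product. *)
Definition gs (m n : nat) : bool :=
  \big[addb/false]_(x < n./2) (n./2 < (m * x.+1) %% n).

Lemma gs_mod m m' n : m = m' %[mod n] -> gs m n = gs m' n.
Proof. by move=> e; apply: eq_bigr => x _; rewrite -modnMml e modnMml. Qed.

Lemma gs1n n : gs 1 n = false.
Proof.
apply: big1 => x _; have := ltn_ord x; rewrite mul1n => lx.
by rewrite modn_small; lia.
Qed.

(** Neither residue is zero, so they add up to [n]; as [n] is odd, exactly one exceeds n/2. *)
Lemma half_flip n a b : odd n -> n %| a + b -> ~~ (n %| a) ->
  (n./2 < b %% n) = ~~ (n./2 < a %% n).
Proof.
move=> on; rewrite /dvdn -modnDm => /eqP ab na.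
have n0 : 0 < n by case: n on {ab na}.
have la := ltn_pmod a n0; have lb := ltn_pmod b n0.
move: (a %% n) (b %% n) ab na la lb => r s ab na la lb.
suff rs : r + s = n by move: on; rewrite -rs; lia.
case: (ltnP (r + s) n) => h.
  by move: ab; rewrite modn_small // => /eqP; rewrite addn_eq0 (negbTE na).
by move: ab; rewrite -(subnK h) modnDr modn_small; lia.
Qed.

Lemma dvdn_half n x m : coprime m n -> x < n./2 -> ~~ (n %| m * x.+1).
Proof.
move=> cmn lx; rewrite Gauss_dvdr; last by rewrite coprime_sym.
by apply/negP => /dvdn_leq; lia.
Qed.

Lemma gs_opp m m' n : odd n -> coprime m n -> n %| m + m' ->
  gs m' n = odd n./2 (+) gs m n.
Proof.
move=> on cmn d.
have -> : odd n./2 = \big[addb/false]_(x < n./2) true.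
  rewrite -[n in odd n]card_ord -sum1_card.
  by rewrite (big_morph odd oddD (erefl _)).
rewrite -big_split; apply: eq_bigr => x _ /=.
by apply: half_flip => //; [rewrite -mulnDl dvdn_mulr | exact: dvdn_half].
Qed.

(** The distance from [a] to the nearest multiple of [n]. *)
Definition absres n a := let r := a %% n in if n./2 < r then n - r else r.

Lemma absres_gt0 n a : odd n -> ~~ (n %| a) -> 0 < absres n a.
Proof.
rewrite /dvdn /absres => on na; have : a %% n < n by rewrite ltn_mod; lia.
by case: ifP; lia.
Qed.

Lemma absres_le n a : odd n -> absres n a <= n./2.
Proof.
rewrite /absres => on; have : a %% n < n by rewrite ltn_mod; lia.
by case: ifP; lia.
Qed.

Lemma halfsys_subproof m n (x : 'I_n./2) :
  (if odd n && coprime m n then (absres n (m * x.+1)).-1 else x) < n./2.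
Proof.
case: ifP => // /andP[on cmn].
have := absres_gt0 on (dvdn_half cmn (ltn_ord x)).
by have := absres_le (m * x.+1) on; lia.
Qed.

(** Multiplication by [m] up to sign on the half system 1, ..., (n-1)/2, indices shifted by one;
    made total by the identity when [n] is even or not coprime to [m]. *)
Definition halfsys (m n : nat) (x : 'I_n./2) : 'I_n./2 := Ordinal (halfsys_subproof m x).

Lemma halfsysE m n (x : 'I_n./2) : odd n -> coprime m n ->
  (@halfsys m n x).+1 = absres n (m * x.+1).
Proof.
move=> on cmn /=; rewrite on cmn /= prednK //.
by apply: absres_gt0 => //; apply: dvdn_half.
Qed.

Lemma absres_eq n a b : odd n -> absres n a = absres n b ->
  (a == b %[mod n]) || (n %| a + b).
Proof.
move=> on; rewrite /dvdn -modnDm /absres.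
have := ltn_pmod a (odd_gt0 on); have := ltn_pmod b (odd_gt0 on).
move: (a %% n) (b %% n) => r s ls lr.
case: ifP => h1; case: ifP => h2 e.
- by rewrite (_ : r = s) ?eqxx //; lia.
- by rewrite (_ : r + s = n) ?modnn ?orbT //; lia.
- by rewrite (_ : r + s = n) ?modnn ?orbT //; lia.
- by rewrite e eqxx.
Qed.

Lemma halfsys_inj m n : odd n -> coprime m n -> injective (@halfsys m n).
Proof.
move=> on cmn x y /(congr1 (fun z : 'I__ => z.+1)).
rewrite !halfsysE // => /(absres_eq on) /orP[|].
  move=> h; apply: val_inj => /=.
  wlog lxy : x y h / x <= y.
    by case: (leqP x y) => [|/ltnW] l w; [exact: w | apply/esym/w; rewrite 1?eq_sym].
  move: h; rewrite eq_sym eqn_mod_dvd ?leq_mul2l ?ltnS ?lxy ?orbT //.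
  rewrite -mulnBr Gauss_dvdr 1?coprime_sym // subSS.
  have := ltn_ord y; have [yx|yx ly /(dvdn_leq yx)] := posnP (y - x); last by lia.
  by move: lxy; rewrite -subn_eq0 => ? _ _; lia.
(* Opposite residues would make [n] divide x + y + 2, which is at most n - 1. *)
rewrite -mulnDr Gauss_dvdr 1?coprime_sym // => /dvdn_leq.
by have := ltn_ord x; have := ltn_ord y; lia.
Qed.

(** Reindex the sum for [m] by the permutation [halfsys m']: the sign of m m' x is the sign of m' x
    times that of m |m' x|. *)
Lemma gsMl m m' n : odd n -> coprime m n -> coprime m' n ->
  gs (m * m') n = gs m n (+) gs m' n.
Proof.
move=> on cm cm'.
rewrite [gs m n](reindex_inj (halfsys_inj on cm')) -big_split.
apply: eq_bigr => x _ /=; rewrite halfsysE // /absres.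
case: ifP => [hr|_]; last by rewrite addbF modnMmr mulnA.
rewrite addbT; apply: half_flip => //.
  rewrite -mulnA -mulnDr dvdn_mull // /dvdn -modnDmr subnK ?modnn //.
  by apply: ltnW; rewrite ltn_mod; lia.
rewrite Gauss_dvdr 1?coprime_sym //.
have l : (m' * x.+1) %% n < n by rewrite ltn_mod; lia.
by apply/negP => /dvdn_leq; lia.
Qed.

(* The residue of m x exceeds n/2 iff some multiple n y exceeds m x by less
   than n/2, and then y is unique and at most (m-1)/2. *)
Lemma gs_lattice m n x : odd n -> odd m -> x < n./2 ->
  (n./2 < (m * x.+1) %% n) =
  \big[addb/false]_(y < m./2)
    ((m * x.+1 < n * y.+1) && (2 * (n * y.+1) < 2 * (m * x.+1) + n)).
Proof.
move=> on om lx.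
have dE := divn_eq (m * x.+1) n.
have lr : (m * x.+1) %% n < n by rewrite ltn_mod; lia.
move: (_ %/ _) (_ %% _) dE lr => q r dE lr.
case: (ltnP n./2 r) => hr.
  have lq : q < m./2 by nia.
  rewrite (bigD1 (Ordinal lq)) //= big1 => [|y]; first by nia.
  rewrite -val_eqE /= => ny; apply: negbTE.
  have [yq|qy] : y < q \/ q < y by lia.
    by nia.
  by nia.
rewrite big1 // => y _; apply: negbTE.
case: (leqP y.+1 q) => hy; nia.
Qed.

Lemma gs_recip m n : odd m -> odd n -> coprime m n ->
  gs m n (+) gs n m = odd (m./2 * n./2).
Proof.
move=> om on cmn.
pose A x y := (m * x.+1 < n * y.+1) && (2 * (n * y.+1) < 2 * (m * x.+1) + n).
pose B x y := (n * y.+1 < m * x.+1) && (2 * (m * x.+1) < 2 * (n * y.+1) + m).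
pose C x y := (2 * (m * x.+1) + n <= 2 * (n * y.+1)).
pose D x y := (2 * (n * y.+1) + m <= 2 * (m * x.+1)).
pose S P := \big[addb/false]_(x < n./2) \big[addb/false]_(y < m./2) (P x y : bool).
have -> : gs m n = S A by apply: eq_bigr => x _; apply: gs_lattice.
have -> : gs n m = S B.
  rewrite /S exchange_big; apply: eq_bigr => x _; exact: gs_lattice.
(* The point reflection of the rectangle exchanges C and D. *)
have CD : S C = S D.
  rewrite /S (reindex_inj rev_ord_inj); apply: eq_bigr => x _.
  rewrite (reindex_inj rev_ord_inj); apply: eq_bigr => y _ /=.
  rewrite /C /D; have := ltn_ord x; have := ltn_ord y => ly lx.
  rewrite !subnSK //.
  have E h u z : odd u -> z < u./2 -> 2 * (h * (u./2 - z)) + 2 * (h * z.+1) = h * u + h.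
    by move=> ou lz; rewrite -mulnDr -mulnDr; nia.
  by have := E m n x on lx; have := E n m y om ly; lia.
(* No lattice point lies on the diagonal, so A, B, C and D partition the rectangle. *)
have T : S A (+) S B (+) (S C (+) S D) = S (fun _ _ => true).
  rewrite -!big_split /=; apply: eq_bigr => x _; rewrite -!big_split /=.
  apply: eq_bigr => y _.
  have : m * x.+1 != n * y.+1.
    apply/eqP => e; have := dvdn_half cmn (ltn_ord x).
    by rewrite e dvdn_mulr.
  rewrite /A /B /C /D; lia.
move: T; rewrite CD addbb addbF => ->.
rewrite mulnC -[X in odd (X * _)]card_ord -[X in odd (_ * X)]card_ord -sum_nat_const.
rewrite (big_morph odd oddD (erefl _)); apply: eq_bigr => x _.
by rewrite -sum1_card (big_morph odd oddD (erefl _)).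
Qed.

Lemma gsMr m n1 n2 : odd n1 -> odd n2 -> coprime m (n1 * n2) ->
  gs m (n1 * n2) = gs m n1 (+) gs m n2.
Proof.
move=> o1 o2.
(* For odd m, reciprocity turns this into multiplicativity in the numerator. *)
wlog om : m / odd m => [w c|].
  case om : (odd m); first exact: w.
  have e1 d : d %| n1 * n2 -> gs (m + n1 * n2) d = gs m d.
    by move=> /dvdnP[k ->]; apply: gs_mod; rewrite addnC modnMDl.
  rewrite -(e1 n1) ?dvdn_mulr // -(e1 n2) ?dvdn_mull // -(e1 (n1 * n2)) //.
  apply: w; first by rewrite oddD oddM om o1 o2.
  by rewrite /coprime gcdnC gcdnDr gcdnC.
move=> c; have /andP[c1 c2] : coprime m n1 && coprime m n2 by rewrite -coprimeMr.
have o12 : odd (n1 * n2) by rewrite oddM o1 o2.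
have R := gs_recip om o12 c; have R1 := gs_recip om o1 c1; have R2 := gs_recip om o2 c2.
rewrite -[gs m (n1 * n2)](addbK (gs (n1 * n2) m)) R.
rewrite -[gs m n1](addbK (gs n1 m)) R1 -[gs m n2](addbK (gs n2 m)) R2.
rewrite gsMl // 1?coprime_sym //.
have -> : odd (m./2 * (n1 * n2)./2) = odd (m./2 * n1./2) (+) odd (m./2 * n2./2).
  have := odd_double_half n1; have := odd_double_half n2; rewrite o1 o2 /= => e2 e1.
  have -> : (n1 * n2)./2 = n1./2 + n2./2 + (n1./2 * n2./2).*2 by nia.
  by rewrite !oddM !oddD odd_double addbF; case: (odd m./2).
by case: (odd _); case: (odd _); case: (gs n1 m); case: (gs n2 m).
Qed.

End GaussSchering.

(** * Identification with the Jacobi symbol *)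

Lemma Fp_natr_eq0 p a : prime p -> (a%:R == 0 :> 'F_p) = (p %| a)%N.
Proof. by move=> pp; rewrite (dvdn_pcharf (pchar_Fp pp)). Qed.

Lemma natr_absres p a : prime p ->
  (a%:R : 'F_p) = (-1) ^+ (p./2 < a %% p)%N * (absres p a)%:R.
Proof.
move=> pp; rewrite -(Fp_nat_mod pp a) /absres.
case: ifP => _ /=; last by rewrite mul1r.
have lt : (a %% p < p)%N by rewrite ltn_mod prime_gt0.
rewrite natrB 1?ltnW // [p%:R](_ : _ = 0); first by rewrite sub0r expr1 mulN1r opprK.
by apply/eqP; rewrite Fp_natr_eq0.
Qed.

(** Multiplication by [m] permutes the half system up to signs; compare the products and cancel
    [P]. *)
Lemma gauss_lemma p m : prime p -> odd p -> coprime m p ->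
  (m%:R : 'F_p) ^+ p./2 = (-1) ^+ gs m p.
Proof.
move=> pp op cmp.
pose P : 'F_p := \prod_(x < p./2) x.+1%:R.
have P0 : P != 0.
  apply/prodf_neq0 => x _; rewrite Fp_natr_eq0 //.
  by have := dvdn_half (coprime1n p) (ltn_ord x); rewrite mul1n.
apply: (mulIf P0).
have -> : m%:R ^+ p./2 * P = \prod_(x < p./2) (m * x.+1)%:R.
  rewrite -[X in _ ^+ X]card_ord -prodr_const -big_split.
  by apply: eq_bigr => x _; rewrite natrM.
rewrite (big_morph _ (@signr_addb _) (erefl _)).
rewrite [P](reindex_inj (halfsys_inj op cmp)) -big_split.
by apply: eq_bigr => x _; rewrite halfsysE // (natr_absres _ pp).
Qed.

(** Euler's criterion: if a = g^i for a generator g of the units, then p - 1 divides i (p-1)/2, so i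
    is even. *)
Lemma Fp_sqrt p (a : 'F_p) : prime p -> odd p -> a != 0 -> a ^+ p./2 = 1 ->
  exists b : 'F_p, a = b ^+ 2.
Proof.
move=> pp op a0 ah.
have /cyclicP[g gE] := field_unit_group_cyclic [set: {unit 'F_p}]%G.
have og : #[g]%g = (p.-1)%N.
  by rewrite orderE -gE card_finField_unit card_Fp.
have ua : a \is a GRing.unit by rewrite unitfE.
have : FinRing.unit _ ua \in [set: {unit 'F_p}]%G by rewrite inE.
rewrite gE => /cycleP[i /(congr1 val)]; rewrite /= => aE.
have {}aE : a = val g ^+ i by rewrite aE FinRing.val_unitX.
move: ah; rewrite aE -exprM => h.
have /eqP : (g ^+ (i * p./2))%g = 1%g by apply: val_inj; rewrite FinRing.val_unitX.
rewrite -order_dvdn og => d.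
have p2 : (2 < p)%N by apply: odd_prime_gt2.
have e2 : (2 %| i)%N.
  have pE : p.-1 = (2 * p./2)%N by lia.
  by move: d; rewrite pE dvdn_pmul2r //; lia.
exists (val g ^+ (i %/ 2)).
by rewrite -exprM divnK.
Qed.

Lemma legendre_gs p (m : nat) : prime p -> odd p -> coprime m p ->
  legendre m p = (-1) ^+ gs m p.
Proof.
move=> pp op cmp.
have npm : ~~ (p %| m)%N by rewrite -prime_coprime // coprime_sym.
rewrite /legendre dvdzE (negbTE npm).
have modE (x : nat) : ((x%:Z * x%:Z - m%:Z) %% p)%Z == 0 = (x * x == m %[mod p])%N.
  by rewrite -PoszM (sameP eqP dvdz_mod0P) -eqz_mod_dvd !modz_nat.
case: existsP => [[x]|].
  rewrite modE => /eqP e.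
  rewrite -(gs_mod e).
  have cx : coprime x p.
    rewrite coprime_sym prime_coprime //; apply: contra npm => d.
    by rewrite /dvdn -e -/(dvdn _ _) dvdn_mull.
  by rewrite gsMl // addbb.
case g : (gs m p) => // nx; case: nx.
have m0 : (m%:R : 'F_p) != 0 by rewrite Fp_natr_eq0.
have [|b bE] := Fp_sqrt pp op m0; first by rewrite gauss_lemma // g.
have lb : (b < p)%N by have := ltn_ord b; rewrite {2}Fp_cast.
exists (Ordinal lb); rewrite modE /=; apply/eqP.
have : ((b * b)%N%:R : 'F_p) = m%:R.
  by rewrite bE natrM expr2; congr (_ * _); apply: val_inj; rewrite /= val_Fp_nat // modn_small.
by move=> /(congr1 val) /=; rewrite !val_Fp_nat // => ->.
Qed.

Lemma jacobi_gs (m n : nat) : odd n -> coprime m n -> jacobi m n = (-1) ^+ gs m n.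
Proof.
move=> on cmn.
have n0 : (0 < n)%N by apply: odd_gt0.
rewrite /jacobi.
have pr : forall f, f \in prime_decomp n -> prime f.1.
  by move=> [p e] /mem_prime_decomp[].
move: on cmn; rewrite {1 2 4}(prod_prime_decomp n0).
elim: (prime_decomp n) pr => [|[p e] s IH] pr.
  by rewrite !big_nil => _ _; rewrite /gs big_ord0.
rewrite !big_cons /= oddM => /andP[oe os]; rewrite coprimeMr => /andP[ce cs].
rewrite gsMr ?coprimeMr ?ce ?cs // signr_addb IH //; last first.
  by move=> f fs; apply: pr; rewrite inE fs orbT.
congr (_ * _).
have pp : prime p by apply: (pr (p, e)); rewrite inE eqxx.
case: e oe ce {pr} => [|e] oe ce; first by rewrite expr0 expn0 /gs big_ord0.
have op : odd p by move: oe; rewrite oddX.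
have cp : coprime m p by move: ce; rewrite coprime_pexpr.
rewrite legendre_gs //.
elim: e {oe ce} => [//|e IHe].
rewrite exprS expnS IHe gsMr ?signr_addb //; first by rewrite oddX op orbT.
by rewrite coprimeMr cp coprimeXr.
Qed.

(** * The continued fraction of e *)

Section ContinuedFractionOfE.
Variable R : realType.
Local Open Scope classical_set_scope.

(* beta_sum n m = (1 / m!) * \int_0^1 x^n (1 - x)^m exp x dx, with exp x expanded
   and integrated termwise. *)
Definition beta_term (n m j : nat) : R :=
  (n + j)`!%:R / (j`!%:R * (n + m + j).+1`!%:R).

Lemma fact_neq0 n : n`!%:R != 0 :> R.
Proof. by rewrite pnatr_eq0 -lt0n fact_gt0. Qed.

Lemma fact_natS n : (n.+1)`!%:R = (n%:R + 1) * n`!%:R :> R.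
Proof. by rewrite factS natrM -natr1. Qed.

Lemma beta_term_gt0 n m j : 0 < beta_term n m j.
Proof. by rewrite divr_gt0 ?mulr_gt0 ?ltr0n ?fact_gt0. Qed.

Lemma cvg_beta_term n m : cvgn (series (beta_term n m)).
Proof.
apply: (series_le_cvg _ _ _ (is_cvg_series_exp_coeff 1)) => j.
- exact/ltW/beta_term_gt0.
- by rewrite /exp_coeff /= divr_ge0 ?exprn_ge0.
- rewrite /exp_coeff /= expr1n mul1r /beta_term invfM mulrCA.
  rewrite ler_piMr ?invr_ge0 // ler_pdivrMr ?ltr0n ?fact_gt0 // mul1r ler_nat.
  by apply: leq_fact; lia.
Qed.

Definition beta_sum n m : R := limn (series (beta_term n m)).

Lemma beta_sum_gt0 n m : 0 < beta_sum n m.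
Proof.
apply: (lt_le_trans (beta_term_gt0 n m 0)).
have -> : beta_term n m 0 = series (beta_term n m) 1 by rewrite seriesEnat /= big_nat1.
apply: nondecreasing_cvgn_le; last exact: cvg_beta_term.
by apply: nondecreasing_series => i _ _; apply/ltW/beta_term_gt0.
Qed.

(** The remainder d u(N) tends to zero because the series of [u] converges. *)
Lemma limn_series_rel (c c' d : R) (f g h u : R ^nat) :
  cvgn (series f) -> cvgn (series g) -> cvgn (series h) -> cvgn (series u) ->
  (forall N, series f N.+1 = c * series g N.+1 + c' * series h N.+1 + d * u N) ->
  limn (series f) = c * limn (series g) + c' * limn (series h).
Proof.
move=> cf cg ch cu E.
have u0 : u @ \oo --> (0 : R) := cvg_series_cvg_0 cu.
suff : [sequence series f n.+1]_n @ \oo --> c * limn (series g) + c' * limn (series h).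
  by rewrite cvg_shiftS => /cvg_lim; apply; exact: Rhausdorff.
rewrite (_ : [sequence _]_n =
  [sequence c * series g n.+1 + c' * series h n.+1 + d * u n]_n); last by apply/funext.
rewrite -[X in _ --> X]addr0; apply: cvgD; last first.
  by rewrite -[X in _ --> X](mulr0 d); apply: cvgM => //; exact: cvg_cst.
by apply: cvgD; apply: cvgM; try exact: cvg_cst;
  rewrite (cvg_shiftS (series _)).
Qed.

(** All three families carry the factor 1/n!, before the integrals of x^n (1-x)^n exp x, x^(n+1)
    (1-x)^n exp x and x^n (1-x)^(n+1) exp x. *)
Definition betaA n := beta_sum n n.
Definition betaB n := beta_sum n.+1 n.
Definition betaC n := n.+1%:R * beta_sum n n.+1.

Ltac beta_field a b c :=
  rewrite /beta_term !(addnS, addSn) ?addn0 !fact_natS -?muln2 ?natrM -!natr1 ?natrD;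
  field; rewrite !fact_neq0 ?andbT /=;
  have := ler0n R a; have := ler0n R b; have := ler0n R c; move=> *;
  do ?[apply/andP; split]; apply: lt0r_neq0; lra.

(** Split the integrand by 1 = x + (1 - x); this holds termwise, without remainder. *)
Lemma betaA_rel n : betaA n = betaB n + betaC n.
Proof.
rewrite -[betaB n]mul1r; apply: (@limn_series_rel _ _ 0 _ _ _ (beta_term 0 0));
  do ?exact: cvg_beta_term.
move=> N; rewrite mul0r addr0 !seriesEnat /= !mulr_sumr -big_split /=.
apply: eq_bigr => j _; beta_field n n j.
Qed.

(* Integration by parts becomes a telescoping sum whose remainder is the
   last argument of limn_series_rel. *)
Lemma betaB_rel n : betaB n = betaC n + betaA n.+1.
Proof.
rewrite -[betaA _]mul1r.
apply: (@limn_series_rel _ _ (-1) _ _ _ (beta_term n.+1 n.+1)); do ?exact: cvg_beta_term.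
move=> N; rewrite !seriesEnat /= !mulr_sumr -big_split /=.
elim: N => [|N IH]; first by rewrite !big_nat1; beta_field n n n.
rewrite [LHS]big_nat_recr // IH [in RHS]big_nat_recr //=; beta_field n n N.
Qed.

(** Comes from integrating the derivative of x^(n+1) (1-x)^(n+2) exp x; the coefficient 2(n+1)
    becomes the growing partial quotient. *)
Lemma betaC_rel n : betaC n = (n.+1).*2%:R * betaA n.+1 + betaB n.+1.
Proof.
have n1 : n.+1%:R != 0 :> R by rewrite pnatr_eq0.
have : beta_sum n n.+1 = 2 * beta_sum n.+1 n.+1 + n.+1%:R^-1 * beta_sum n.+2 n.+1.
  apply: (@limn_series_rel _ _ (n.+2%:R / n.+1%:R) _ _ _ (beta_term n.+1 n.+2));
    do ?exact: cvg_beta_term.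
  move=> N; rewrite !seriesEnat /= !mulr_sumr -big_split /=.
  elim: N => [|N IH]; first by rewrite !big_nat1; beta_field n n n.
  rewrite [LHS]big_nat_recr // IH [in RHS]big_nat_recr //=; beta_field n n N.
by rewrite /betaC /betaA /betaB => ->; rewrite -muln2 natrM; field.
Qed.

(** The sum telescopes: its j-th term is 1/(j+1)! - 1/(j+2)!. *)
Lemma beta_sum10 : beta_sum 1 0 = 1.
Proof.
suff : series (beta_term 1 0) @ \oo --> (1 : R) by move/cvg_lim; apply; exact: Rhausdorff.
have -> : series (beta_term 1 0) = [sequence 1 - exp_coeff 1 n.+1]_n.
  apply/funext => n; rewrite seriesEnat /= /exp_coeff /= expr1n.
  elim: n => [|n IH]; first by rewrite big_geq // divr1 subrr.
  rewrite big_nat_recr //= IH; beta_field n n n.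
rewrite -[X in _ --> X]subr0; apply: cvgB; first exact: cvg_cst.
by rewrite (cvg_shiftS (exp_coeff 1)); exact: cvg_exp_coeff.
Qed.

Lemma expR1_rel : expR 1 = 2 * betaB 0 + betaC 0.
Proof.
suff -> : expR 1 = 1 + betaA 0.
  by rewrite betaA_rel /betaB beta_sum10; lra.
have c := @cvg_beta_term 0 0; rewrite /betaA /beta_sum.
suff : series (exp_coeff 1) @ \oo --> 1 + limn (series (beta_term 0 0)).
  by move=> h; apply: cvg_lim h; exact: Rhausdorff.
rewrite -cvg_shiftS (_ : [sequence _]_n = [sequence 1 + series (beta_term 0 0) n]_n).
  by apply: cvgD => //; exact: cvg_cst.
apply/funext => n /=; rewrite !seriesEnat /= big_nat_recl //=.
congr (_ + _); first by rewrite /exp_coeff /= expr1n fact0 divr1.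
apply: eq_bigr => j _; rewrite /exp_coeff /= expr1n /beta_term !add0n.
by rewrite invfM mulrA divff ?fact_neq0.
Qed.

Lemma betaA_gt0 n : 0 < betaA n. Proof. exact: beta_sum_gt0. Qed.
Lemma betaB_gt0 n : 0 < betaB n. Proof. exact: beta_sum_gt0. Qed.
Lemma betaC_gt0 n : 0 < betaC n. Proof. by rewrite mulr_gt0 // beta_sum_gt0. Qed.

(** * The partial quotients of e *)

Definition e_quot (k : nat) : nat :=
  if k is 0 then 2%N else if (k %% 3 == 2)%N then (k %/ 3).+1.*2 else 1%N.

(* e_gap k = |t_{k-2} e - s_{k-2}|, with s_{-2} = 0 and t_{-2} = 1. *)
Definition e_gap (k : nat) : R :=
  if k is k'.+1 then
    nth 0 [:: betaB (k' %/ 3); betaC (k' %/ 3); betaA (k' %/ 3).+1] (k' %% 3)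
  else expR 1.

Arguments e_gap : simpl never.

Lemma nat3_ind (P : nat -> Prop) :
  (forall i, P (i * 3)%N /\ P (i * 3).+1 /\ P (i * 3).+2) -> forall k, P k.
Proof.
move=> h k; rewrite (divn_eq k 3); have [h0 [h1 h2]] := h (k %/ 3)%N.
have : (k %% 3 < 3)%N by rewrite ltn_mod.
by case: (k %% 3)%N => [|[|[|]]] // _; rewrite ?addn0 ?addn1 ?addn2.
Qed.

Lemma divn_mod3 (i : nat) :
  (((i * 3) %/ 3 = i)%N * ((i * 3).+1 %/ 3 = i)%N *
  ((i * 3).+2 %/ 3 = i)%N * ((i * 3) %% 3 = 0)%N *
  ((i * 3).+1 %% 3 = 1)%N * ((i * 3).+2 %% 3 = 2)%N *
  ((i * 3).+3 %/ 3 = i.+1)%N * ((i * 3).+3 %% 3 = 0)%N *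
  ((i * 3).+4 %/ 3 = i.+1)%N * ((i * 3).+4 %% 3 = 1)%N)%type.
Proof. by do !split; lia. Qed.

Lemma e_gap_gt0 k : 0 < e_gap k.
Proof.
case: k => [|k]; first exact: expR_gt0.
elim/nat3_ind: k => i; rewrite /e_gap !divn_mod3 /=.
by rewrite betaA_gt0 betaB_gt0 betaC_gt0.
Qed.

Lemma e_gap_rel k : e_gap k = (e_quot k)%:R * e_gap k.+1 + e_gap k.+2.
Proof.
case: k => [|k]; first exact: expR1_rel.
elim/nat3_ind: k => i; rewrite /e_gap /e_quot !divn_mod3 /= !mul1r.
by rewrite -betaC_rel -betaB_rel -betaA_rel.
Qed.

Lemma e_quot_gt0 k : (0 < e_quot k)%N.
Proof. by case: k => // k; rewrite /e_quot; case: ifP. Qed.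

(** The gaps run through the Euclidean algorithm: they strictly decrease from index 1 on, since each
    quotient is at least 1 and each gap positive. *)
Lemma floor_e_gap k : Num.floor (e_gap k / e_gap k.+1) = e_quot k.
Proof.
have g0 := e_gap_gt0 k.+1; have g1 := e_gap_gt0 k.+2; have g2 := e_gap_gt0 k.+3.
apply: floor_def; rewrite intrD -pmulrn ler_pdivlMr // ltr_pdivrMr // (e_gap_rel k).
rewrite lerDl ltW // mulrDl ltrD2l mul1r (e_gap_rel k.+1).
have : 1 <= (e_quot k.+1)%:R :> R by rewrite ler1n e_quot_gt0.
by move=> h; rewrite ltr_pwDr // ler_peMl // ltW.
Qed.

Lemma cf_rem_e k : cf_rem (expR 1 : R) k = e_gap k / e_gap k.+1.
Proof.
elim: k => [|k IH] /=.
  by rewrite [e_gap 1]/(betaB 0) /betaB beta_sum10 divr1.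
rewrite IH floor_e_gap -pmulrn (e_gap_rel k).
have := e_gap_gt0 k.+1; have := e_gap_gt0 k.+2.
move: (e_gap k.+1) (e_gap k.+2) => x y /lt0r_neq0 y0 /lt0r_neq0 x0.
by rewrite mulrDl mulfK // [_ + y / x]addrC addrK invf_div.
Qed.

Lemma cf_a_e k : cf_a (expR 1 : R) k = e_quot k.
Proof. by rewrite /cf_a cf_rem_e floor_e_gap. Qed.

End ContinuedFractionOfE.

(** * The convergents of e and the automaton *)

Section ConvergentsOfE.
Local Open Scope nat_scope.
Arguments e_quot : simpl never.

Fixpoint e_rec (x y k : nat) : nat * nat :=
  if k is k'.+1 then
    let: (u, v) := e_rec x y k' in (v, e_quot k * v + u)
  else (x, y).

(* e_num k = (s_{k-1}, s_k) and e_den k = (t_{k-1}, t_k). *)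
Definition e_num := e_rec 1 2.
Definition e_den := e_rec 0 1.

Lemma conv_aux_e (R : realType) k : conv_aux (expR 1 : R) k =
  (Posz (e_num k).1, Posz (e_num k).2, Posz (e_den k).1, Posz (e_den k).2).
Proof.
rewrite /e_num /e_den; elim: k => [|k IH]; first by rewrite /= cf_a_e.
rewrite [LHS]/= {}IH cf_a_e /=.
by case: (e_rec 1 2 k) => ? ?; case: (e_rec 0 1 k).
Qed.

Lemma e_denS k : e_den k.+1 =
  ((e_den k).2, e_quot k.+1 * (e_den k).2 + (e_den k).1).
Proof. by rewrite /e_den /=; case: e_rec. Qed.

Lemma e_numS k : e_num k.+1 =
  ((e_num k).2, e_quot k.+1 * (e_num k).2 + (e_num k).1).
Proof. by rewrite /e_num /=; case: e_rec. Qed.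

Lemma e_conv_det k : (e_num k).2 * (e_den k).1 + ~~ odd k = (e_num k).1 * (e_den k).2 + odd k.
Proof.
elim: k => // k; rewrite e_denS e_numS /=.
move: (e_num k) (e_den k) => [a b] [c d] /=; move: (e_quot _) => q.
by case: (odd k) => /= h; nia.
Qed.

Lemma coprime_e_den k : coprime (e_den k).1 (e_den k).2.
Proof.
elim: k => // k IH; rewrite e_denS /=.
by rewrite /coprime gcdnMDl gcdnC.
Qed.

Lemma coprime_e_conv k : coprime (e_num k).2 (e_den k).2.
Proof.
have := e_conv_det k; set s := (e_num k).2; set t := (e_den k).2; move=> E.
have ds : gcdn s t %| s := dvdn_gcdl s t.
have dt : gcdn s t %| t := dvdn_gcdr s t.
rewrite /coprime -dvdn1; case: (odd k) E => /=; rewrite addn0.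
  by move=> E; rewrite -(dvdn_addr 1 (dvdn_mull (e_num k).1 dt)) -E dvdn_mulr.
by move=> E; rewrite -(dvdn_addr 1 (dvdn_mulr (e_den k).1 ds)) E dvdn_mull.
Qed.

(** Modulo t_k the product s_k t_{k-1} is 1 for odd k and -1 for even k. *)
Lemma gs_e_conv k : odd (e_den k).2 ->
  gs (e_num k).2 (e_den k).2 =
  gs (e_den k).1 (e_den k).2 (+) (~~ odd k && odd (e_den k).2./2).
Proof.
move=> ot; have cs := coprime_e_conv k; have ct := coprime_e_den k.
rewrite -[LHS](addbK (gs (e_den k).1 (e_den k).2)) -gsMl // addbC; congr (_ (+) _).
have := e_conv_det k; case: (odd k) => /=; rewrite addn0 => E.
  by rewrite E (gs_mod (m' := 1)) ?gs1n // modnMDl.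
by rewrite (@gs_opp 1) ?gs1n ?addbF ?coprime1n // addnC E dvdn_mull.
Qed.

(* (t_{k-1} mod 4, t_k mod 4, (t_k / t_{k-1}), (t_{k-1} / t_k)); a symbol is
   meaningful only when its denominator is odd. *)
Definition residue_state := (nat * nat * bool * bool)%type.

(** For even [y] the formula presupposes a = 1: then y = -x modulo z = x + y, and z = y modulo x, so
    reciprocity for x and z leads back to [p]. For even [z] the value [false] is a placeholder. *)
Definition next_state (a : nat) (s : residue_state) : residue_state :=
  let: (x, y, p, q) := s in
  let z := (a * y + x) %% 4 in
  (y, z, q, if ~~ odd z then false
            else if odd y then q (+) ((y == 3) && (z == 3))
            else p (+) ((x == 3) && (z == 3)) (+) (z == 3)).

Fixpoint e_state (k : nat) : residue_state :=
  if k is k'.+1 then next_state (e_quot k %% 4) (e_state k') else (0, 1, false, false).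

(** The initial state recurs after 24 steps, and from index 1 on the quotients repeat modulo 4 under
    a shift by 24. *)
Lemma e_state_period k : e_state (k + 24) = e_state k.
Proof.
elim: k => [|k IH]; first by vm_compute.
rewrite addSn [LHS]/= IH -addSn; congr (next_state _ _).
by rewrite /e_quot; case: ifP => h; case: ifP => h'; lia.
Qed.

Lemma e_state_mod k : e_state k = e_state (k %% 24).
Proof.
rewrite {1}(divn_eq k 24); elim: (k %/ 24) => // n IH.
by rewrite mulSn -addnA addnC e_state_period.
Qed.

(** Over one period, t_k is never even just before an index congruent to 2 modulo 3, where the
    quotients other than 1 stand. *)
Lemma e_state_even k : ~~ odd (e_state k).1.1.2 -> e_quot k.+1 = 1.
Proof.
rewrite e_state_mod => h.
have : k %% 24 < 24 by rewrite ltn_mod.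
have /allP H : all (fun i => odd (e_state i).1.1.2 || (i.+1 %% 3 != 2)) (iota 0 24).
  by vm_compute.
move=> lk; have := H (k %% 24); rewrite mem_iota lk (negbTE h) => /(_ isT) /= h3.
by rewrite /e_quot ifF //; apply/negbTE; move: h3; lia.
Qed.

Lemma odd_half_mod4 n : odd n -> odd n./2 = (n %% 4 == 3).
Proof. by lia. Qed.

Lemma odd_mod4 n : odd (n %% 4) = odd n.
Proof. by lia. Qed.

Lemma gs_recip4 m n : odd m -> odd n -> coprime m n ->
  gs m n = gs n m (+) ((m %% 4 == 3) && (n %% 4 == 3)).
Proof.
move=> om on c; rewrite -[LHS](addbK (gs n m)) gs_recip // addbC; congr (_ (+) _).
by rewrite oddM !odd_half_mod4.
Qed.

Lemma e_stateP k : exists p q,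
  [/\ e_state k = ((e_den k).1 %% 4, (e_den k).2 %% 4, p, q),
      odd (e_den k).1 -> p = gs (e_den k).2 (e_den k).1 &
      odd (e_den k).2 -> q = gs (e_den k).1 (e_den k).2].
Proof.
elim: k => [|k [p [q [E Hp Hq]]]].
  by exists false, false; split => // _; rewrite /gs big_ord0.
have Q1 : ~~ odd (e_den k).2 -> e_quot k.+1 = 1.
  by move=> h; apply: e_state_even; rewrite E /= odd_mod4.
have := coprime_e_den k.+1; have := coprime_e_den k.
rewrite [e_state _]/= E e_denS /=.
move: (e_den k) Q1 Hp Hq => [x y] /=; move: (e_quot k.+1) => a Q1 Hp Hq cxy cyz.
rewrite modnDmr -modnDml modnMm modnDml !odd_mod4.
eexists; eexists; split; first by [].
  by move=> oy; rewrite Hq //; apply: gs_mod; rewrite modnMDl.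
move=> oz; rewrite oz /=; case: ifP => [oy|ey].
  by rewrite [RHS]gs_recip4 // Hq //; congr (_ (+) _); apply: gs_mod; rewrite modnMDl.
move: oz cyz; rewrite Q1 ?ey // mul1n => oz cyz.
have ox : odd x by move: oz; rewrite oddD ey.
have cxz : coprime x (y + x) by rewrite /coprime gcdnDr.
have -> : gs y (y + x) = odd (y + x)./2 (+) gs x (y + x).
  by apply: gs_opp; rewrite // addnC.
rewrite odd_half_mod4 // gs_recip4 // Hp // (@gs_mod y (y + x)) ?modnDr //.
by rewrite addbC.
Qed.

Definition e_jac (k : nat) : jac_val :=
  let: (_, y, _, q) := e_state k in
  if ~~ odd y then JStar
  else if q (+) (~~ odd k && (y == 3)) then JNeg else JPos.

Lemma jacobi_seq_e (R : realType) k : jacobi_seq (expR 1 : R) k = e_jac k.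
Proof.
rewrite /jacobi_seq /conv_s /conv_t conv_aux_e /jac_sym /e_jac !absz_nat coprime_e_conv.
have [p [q [-> _ Hq]]] := e_stateP k; rewrite odd_mod4.
case: ifP => // /negbFE oy; rewrite jacobi_gs ?coprime_e_conv // gs_e_conv //.
by rewrite Hq // odd_half_mod4 //; case: (_ (+) _).
Qed.

Lemma e_jac_period k : e_jac (k + 24) = e_jac k.
Proof. by rewrite /e_jac e_state_period oddD addbF. Qed.

(** Codes in [nat] let the comparison of symbols be evaluated. *)
Definition jac_code (v : jac_val) : nat :=
  match v with JPos => 0 | JNeg => 1 | JStar => 2 | JUndef => 3 end.

(** For every smaller shift, computation finds a mismatch among the first 24 indices. *)
Lemma e_jac_min L : 0 < L < 24 -> exists k, e_jac k <> e_jac (k + L).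
Proof.
have /allP H : all (fun l => has (fun k => jac_code (e_jac k) != jac_code (e_jac (k + l)))
   (iota 0 24)) (iota 1 23) by vm_compute.
move=> hL; have /hasP[k _ /eqP ne] : has _ (iota 0 24) := H L ltac:(by rewrite mem_iota).
by exists k => e; apply: ne; rewrite e.
Qed.

End ConvergentsOfE.

Theorem theorem1 (R : realType) :
  (forall k : nat, jacobi_seq (expR 1 : R) k = jacobi_seq (expR 1 : R) (k + 24)%N) /\
  (forall L : nat, (0 < L)%N ->
     (forall k : nat, jacobi_seq (expR 1 : R) k = jacobi_seq (expR 1 : R) (k + L)%N) ->
     (24 <= L)%N).
Proof.
split=> [k|L L0 h]; first by rewrite !jacobi_seq_e e_jac_period.
rewrite leqNgt; apply/negP => L24.
have [k] := @e_jac_min L ltac:(by rewrite L0).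
by rewrite -!(jacobi_seq_e R); apply; exact: h.
Qed.
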